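(* Let $\varepsilon\in(0,1)$ and $c\ge\frac{1}{\varepsilon}+1$. Then there is a feasible $\varepsilon$-slack insert state $(I,S,k)$ in which every window has length $c$, such that every allocator that solves it makes at least $\lfloor\log_{1+\varepsilon}(\frac{1}{\varepsilon})\rfloor$ reallocations, i.e. every solution $S'$ for $I$ produced satisfies $\#\{i\ne k: S'[i]\ne S[i]\}\ge\lfloor\log_{1+\varepsilon}(\frac{1}{\varepsilon})\rfloor$.
   Context: Single processor, unit-length tasks. A window is a closed real interval; a slot is a closed real interval of length $1$. Two intervals overlap iff their interiors intersect. An instance $I=(n,T,W)$ consists of $n$ tasks $T[1..n]$ with windows $W[1..n]$. A valid allocation $S$ assigns to each task $T[i]$ either a slot $S[i]\subseteq W[i]$ or $null$, with no two allocated slots overlapping; a solution allocates all tasks; a partial solution for $(I,k)$ is a valid allocation allocating all tasks except $T[k]$ (with $S[k]=null$). $I$ is feasible iff it has a solution. A $\gamma$-partial solution for $(I,k)$ assigns to each task $T[i]$, $i\ne k$, an interval of length $\gamma$ inside $W[i]$, pairwise non-overlapping. An insert state $(I,S,k)$ is a triple with $S$ a partial solution for $(I,k)$ (representing the state right after inserting $T[k]$); it is feasible iff $I$ is feasible, and $\varepsilon$-slack iff there is a $(1+\varepsilon)$-partial solution for $(I,k)$. An allocator solves an insert state by outputting a solution $S'$ for $I$; the number of reallocations is the number of $i\ne k$ with $S'[i]\ne S[i]$. *)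

(* Defs.v *)
From HB Require Import structures.
From mathcomp Require Import all_boot all_order all_algebra.
From mathcomp Require Import all_classical all_reals all_analysis.

Set Implicit Arguments.
Unset Strict Implicit.
Unset Printing Implicit Defensive.

Import Order.TTheory GRing.Theory Num.Theory.
Import numFieldNormedType.Exports.

Local Open Scope classical_set_scope.
Local Open Scope ring_scope.

Definition logb (R : realType) (b x : R) : R := ln x / ln b.

(* A closed interval is encoded by its pair of endpoints, which makes equality
   of slots decidable; [cset] is the interval as a set of reals. *)
Definition cset (R : realType) (J : R * R) : set R := `[J.1, J.2].

Definition len (R : realType) (J : R * R) : R := J.2 - J.1.

Definition overlap (R : realType) (J K : R * R) : Prop :=
  (cset J)° `&` (cset K)° !=set0.

(* Tasks carry no data besides their window, so a task is just its index. *)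
Record instance (R : realType) := Instance {
  ntasks : nat;
  window : 'I_ntasks -> R * R;
  window_le : forall i, (window i).1 <= (window i).2 }.

(* [None] is null. *)
Definition allocation (R : realType) (I : instance R) : Type :=
  'I_(ntasks I) -> option (R * R).

(* Allocated intervals have length g: g = 1 for slots, g = 1 + eps for slack. *)
Definition valid (R : realType) (g : R) (I : instance R) (S : allocation I) :
    Prop :=
  (forall i J, S i = Some J -> len J = g /\ cset J `<=` cset (window i)) /\
  (forall i j J K, i != j -> S i = Some J -> S j = Some K -> ~ overlap J K).

Definition solution (R : realType) (I : instance R) (S : allocation I) : Prop :=
  valid 1 S /\ forall i, S i <> None.

(* At g = 1 this is a partial solution for (I, k), otherwise a g-partial one. *)
Definition partial_solution (R : realType) (g : R) (I : instance R)
    (k : 'I_(ntasks I)) (S : allocation I) : Prop :=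
  valid g S /\ forall i, S i = None <-> i = k.

Definition feasible (R : realType) (I : instance R) : Prop :=
  exists S : allocation I, solution S.

Record insert_state (R : realType) := InsertState {
  st_inst : instance R;
  st_alloc : allocation st_inst;
  st_task : 'I_(ntasks st_inst);
  st_partial : partial_solution 1 st_task st_alloc }.

Arguments st_alloc {R} st i : rename.

Definition st_feasible (R : realType) (st : insert_state R) : Prop :=
  feasible (st_inst st).

Definition slack (R : realType) (eps : R) (st : insert_state R) : Prop :=
  exists S : allocation (st_inst st),
    partial_solution (1 + eps) (st_task st) S.

Definition reallocations (R : realType) (st : insert_state R)
    (S' : allocation (st_inst st)) : nat :=
  #|[pred i : 'I_(ntasks (st_inst st)) |
      (i != st_task st) && (S' i != st_alloc st i)]|.

(* Main.v *)
Require Import Defs.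
From mathcomp Require Import all_boot all_order all_algebra.
From mathcomp Require Import all_classical all_reals all_analysis.
From mathcomp Require Import ring lra.
Import Order.TTheory GRing.Theory Num.Theory.
Local Open Scope ring_scope.

(** Tasks 1, ..., N are packed without gaps at [0, N], whereas task i may go no
    further right than max(c, i(1+eps)); task 0 is the inserted one. In any
    solution the i tasks 0, ..., i-1 start at nonnegative times, so one of them
    ends at i or later. If c < i, it is a task j with i <= j(1+eps), and it
    was reallocated since it used to end at j < i. Iterating from i = N+1 gives
    a chain of reallocated tasks whose indices shrink by a factor at most 1+eps
    until they drop to c. Windows of length c allow N = floor((c-1)/eps), and
    (c-1)/eps >= c/(eps(1+eps)), which makes the chain long enough. *)

(** * Overlap and inclusion in terms of endpoints *)

Lemma overlapP (R : realType) (J K : R * R) :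
  overlap J K <-> Num.max J.1 K.1 < Num.min J.2 K.2.
Proof.
rewrite /overlap /cset !interior_itv_bnd; split.
  move=> [x [/=]]; rewrite !in_itv /= => /andP[J1 J2] /andP[K1 K2].
  by apply: (@lt_trans _ _ x); rewrite ?gt_max ?lt_min ?J1 ?J2 ?K1 ?K2.
move=> h; exists ((Num.max J.1 K.1 + Num.min J.2 K.2) / 2).
have [] := midf_lt h.
rewrite gt_max lt_min => /andP[J1 K1] /andP[J2 K2].
by split=> /=; rewrite in_itv /= ?J1 ?J2 ?K1 ?K2.
Qed.

Lemma subset_csetP (R : realType) (J K : R * R) : J.1 <= J.2 ->
  (cset J `<=` cset K)%classic <-> K.1 <= J.1 /\ J.2 <= K.2.
Proof.
move=> hJ; split=> [sub | [h1 h2] x].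
  have := sub J.1; have := sub J.2.
  rewrite /cset /= !in_itv /= !lexx hJ => /(_ isT) /andP[_ ?] /(_ isT).
  by case/andP.
by rewrite /cset /= !in_itv /= => /andP[/(le_trans h1) -> /le_trans ->].
Qed.

(** * Allocations on a grid of mesh [g] *)

Section Grid.
Variables (R : realType) (I : instance R) (g : R).
Variables (P : pred 'I_(ntasks I)) (h : 'I_(ntasks I) -> nat).

(** Covers all three allocations needed: the packed one and the slack one, where [P] leaves out task
    0, and the solution showing feasibility, where [P] is empty. *)
Definition grid : allocation I := fun i =>
  if P i then None else Some ((h i)%:R * g, (h i).+1%:R * g).

Lemma valid_grid : 0 <= g ->
  (forall i j, ~~ P i -> ~~ P j -> h i = h j -> i = j) ->
  (forall i, ~~ P i ->
     (window i).1 <= (h i)%:R * g /\ (h i).+1%:R * g <= (window i).2) ->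
  valid g grid.
Proof.
move=> g0 inj win; split=> [i J | i j J K ij]; rewrite /grid.
  case: ifP => // /negbT Pi [<-]; split; first by rewrite /len /= -natr1; ring.
  by apply/subset_csetP; [rewrite /= ler_wpM2r // ler_nat | exact: win].
case: ifP => // /negbT Pi [<-]; case: ifP => // /negbT Pj [<-].
move/overlapP; rewrite gt_max !lt_min /= => /andP[/andP[_ b] /andP[a _]].
case: (ltngtP (h i) (h j)) => [lt|lt|/(inj _ _ Pi Pj) eq].
- have := ler_wpM2r g0 (_ : (h i).+1%:R <= (h j)%:R).
  by rewrite ler_nat lt leNgt a => /(_ isT).
- have := ler_wpM2r g0 (_ : (h j).+1%:R <= (h i)%:R).
  by rewrite ler_nat lt leNgt b => /(_ isT).
- by rewrite eq eqxx in ij.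
Qed.

End Grid.

(** Pigeonhole: starts with equal integer parts are less than 1 apart, so if all starts were below
    n, truncation would inject n+1 indices into n values. *)
Lemma exists_late_slot (R : realType) (n : nat) (s : 'I_n.+1 -> R) :
  (forall i, 0 <= s i) ->
  (forall i j, i != j -> s i < s j + 1 -> s j < s i + 1 -> False) ->
  exists i, n%:R <= s i.
Proof.
move=> s0 sep; apply: contrapT => none.
have lt i : (Num.truncn (s i) < n)%N.
  by rewrite truncn_lt_nat // ltNge; apply/negP => ?; apply: none; exists i.
have inj : injective (fun i => Ordinal (lt i)).
  move=> i j [eq]; apply/eqP/negPn/negP => ij.
  have := truncn_itv (s0 i); have := truncn_itv (s0 j).
  rewrite eq -natr1 => /andP[? ?] /andP[? ?].
  by apply: (sep i j ij); lra.
by have := leq_card _ inj; rewrite !card_ord ltnn.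
Qed.

(** * The insert state *)

Section Construction.
Variables (R : realType) (eps c : R) (N : nat).
Hypotheses (eps_gt0 : 0 < eps) (hc : eps^-1 + 1 <= c).
Hypothesis hN : N%:R * eps <= c - 1.

(** The term i(1+eps) is the right end of task i in the slack packing; the maximum with c keeps all
    window starts nonnegative. *)
Definition deadline (i : nat) : R := Num.max c (i%:R * (1 + eps)).

Let c_gt1 : 1 < c.
Proof. by apply: lt_le_trans hc; rewrite ltrDr invr_gt0. Qed.

Let window_fun (i : 'I_N.+1) : R * R := (deadline i - c, deadline i).

Let window_fun_le i : (window_fun i).1 <= (window_fun i).2.
Proof. by rewrite /= gerBl ltW // (lt_trans _ c_gt1). Qed.

Definition packed_instance : instance R :=
  @Instance R N.+1 window_fun window_fun_le.

(** This is where N is bounded: i(1+eps) - c <= i-1 amounts to i*eps <= c-1. *)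
Lemma deadline_start (i : 'I_N.+1) : i != ord0 -> deadline i - c <= i.-1%:R.
Proof.
move=> i0; have i1 : (0 < i)%N by rewrite lt0n.
rewrite /deadline lerBlDr ge_max lerDr ler0n /= -{1}(prednK i1) -natr1.
have : i%:R * eps <= N%:R * eps by rewrite ler_pM2r // ler_nat -ltnS.
by rewrite -{1}(prednK i1) -natr1; move: hN; lra.
Qed.

Lemma le_deadline (i : nat) (x : R) : x <= c \/ x <= i%:R * (1 + eps) ->
  x <= deadline i.
Proof. by rewrite /deadline le_max => -[->|->]; rewrite ?orbT. Qed.

Definition packed : allocation packed_instance :=
  @grid R packed_instance 1 (pred1 ord0) (fun i : 'I_N.+1 => i.-1).

Lemma pred_inj_pos (i j : 'I_N.+1) : i != ord0 -> j != ord0 ->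
  i.-1 = j.-1 -> i = j.
Proof.
by move=> i0 j0 /(congr1 S); rewrite !prednK ?lt0n // => /val_inj.
Qed.

Lemma grid_None g (i : 'I_N.+1) :
  @grid R packed_instance g (pred1 ord0) (fun i : 'I_N.+1 => i.-1) i = None
  <-> i = ord0.
Proof. by rewrite /grid; case: ifP => /= /eqP. Qed.

Lemma packed_partial : partial_solution 1 (ord0 : 'I_(ntasks packed_instance)) packed.
Proof.
split; last exact: grid_None.
apply: valid_grid => //; first exact: pred_inj_pos.
move=> i /= i0; rewrite !mulr1; split; first exact: deadline_start.
rewrite prednK ?lt0n //; apply: le_deadline; right.
by rewrite ler_peMr // lerDl ltW.
Qed.

Definition packed_state : insert_state R := InsertState packed_partial.

Lemma packed_window_len (i : 'I_(ntasks packed_instance)) : len (window i) = c.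
Proof. by rewrite /len /=; ring. Qed.

Lemma packed_feasible : st_feasible packed_state.
Proof.
exists (@grid R packed_instance 1 pred0 (fun i : 'I_N.+1 => i : nat)); split=> //.
apply: valid_grid => // [i j _ _|i _]; first exact: val_inj.
rewrite !mulr1 /=; split.
  case: (eqVneq i ord0) => [->|i0].
    by rewrite /deadline mul0r max_l ?subrr // ltW // (lt_trans _ c_gt1).
  by apply: le_trans (deadline_start i i0) _; rewrite ler_nat leq_pred.
(* If the slot [i, i+1] ends after c >= 1/eps + 1, then i*eps > 1, hence i+1 <= i(1+eps). *)
apply: le_deadline; case: (leP (i.+1%:R : R) c) => [|ci]; [by left|right].
move: ci; rewrite -natr1 => /(le_lt_trans hc) ci; rewrite mulrDr mulr1 lerD2l.
by rewrite -ler_pdivrMr // div1r ltW // -(ltrD2r 1).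
Qed.

Lemma packed_slack : eps < 1 -> slack eps packed_state.
Proof.
move=> eps_lt1.
exists (@grid R packed_instance (1 + eps) (pred1 ord0) (fun i : 'I_N.+1 => i.-1)).
split; last exact: grid_None.
apply: valid_grid; [by move: eps_gt0; lra|exact: pred_inj_pos|].
move=> i /= i0; rewrite prednK ?lt0n //.
split; last by apply: le_deadline; right.
rewrite /deadline lerBlDr ge_max lerDr mulr_ge0 ?ler0n //=; last first.
  by move: eps_gt0; lra.
have i1 : (0 < i)%N by rewrite lt0n.
(* What remains is 1+eps <= c, which holds since eps < 1 < 1/eps. *)
rewrite -{1}(prednK i1) -natr1 mulrDl mul1r lerD2l.
apply: le_trans hc; rewrite addrC lerD2r.
by rewrite ltW // (lt_trans eps_lt1) // invf_gt1.
Qed.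

(** * The chain of forced reallocations *)

Section Reallocation.
Variables (S : allocation packed_instance) (Ssol : solution S).

Definition moved_below (i : nat) : {set 'I_N.+1} :=
  [set j : 'I_N.+1 | [&& (j < i)%N, j != ord0 & S j != packed j]].

Lemma late_task (i : nat) : (0 < i <= N.+1)%N ->
  exists2 j : 'I_N.+1, (j < i)%N &
    exists2 J, S j = Some J & i%:R <= J.2 <= deadline j.
Proof.
case: i => // n /= nN; have [[Swin Ssep] Sall] := Ssol.
have slot (j : 'I_N.+1) : {J | S j = Some J}.
  by case E: (S j) => [J|]; [exists J|case: (Sall j)].
have fits (j : 'I_N.+1) :
    [/\ 0 <= (sval (slot j)).1, (sval (slot j)).2 = (sval (slot j)).1 + 1
      & (sval (slot j)).2 <= deadline j].
  have [lenJ sub] := Swin _ _ (svalP (slot j)).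
  move: lenJ; rewrite /len => lenJ.
  have eq2 : (sval (slot j)).2 = (sval (slot j)).1 + 1 by rewrite -lenJ; ring.
  move: sub; rewrite subset_csetP ?eq2 ?lerDl //= => -[lo hi].
  by split=> //; apply: le_trans lo; rewrite subr_ge0 le_max lexx.
(* Here i = n+1: among the n+1 tasks below i, one starts at n or later and so ends at i or later. *)
pose w := widen_ord nN.
have [||i le] := @exists_late_slot R n (fun i => (sval (slot (w i))).1).
- by move=> i; case: (fits (w i)).
- move=> i j ij lt1 lt2.
  have wij : w i != w j by [].
  apply: (Ssep _ _ _ _ wij (svalP (slot (w i))) (svalP (slot (w j)))).
  have [_ ei _] := fits (w i); have [_ ej _] := fits (w j).
  by apply/overlapP; rewrite gt_max !lt_min ei ej lt1 lt2 !ltrDl !ltr01.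
exists (w i); first exact: (ltn_ord i).
exists (sval (slot (w i))); first exact: svalP (slot (w i)).
by have [_ e ->] := fits (w i); rewrite andbT e -natr1 lerD2r.
Qed.

(* The hypothesis says that i(1+eps)^(1-t) exceeds c: t steps down from i,
   each by a factor at most 1+eps, start above c. *)
Lemma moved_below_ge (t i : nat) : (i <= N.+1)%N ->
  c * (1 + eps) ^+ t < i%:R * (1 + eps) -> (t <= #|moved_below i|)%N.
Proof.
have eps1 : 0 < 1 + eps by move: eps_gt0; lra.
elim: t i => // t IH i iN; rewrite exprSr mulrA ltr_pM2r // => lt.
have ci : c < i%:R.
  apply: le_lt_trans lt; rewrite ler_peMr //.
    by rewrite ltW // (lt_trans _ c_gt1).
  by rewrite exprn_ege1 // lerDl ltW.
have i0 : (0 < i)%N.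
  by rewrite -(ltr_nat R); apply: lt_trans ci; apply: lt_trans c_gt1.
have [|j ji [J SJ /andP[iJ]]] := @late_task i; first by rewrite i0.
rewrite /deadline le_max => /orP[Jc|Jj].
  by have := le_lt_trans (le_trans iJ Jc) ci; rewrite ltxx.
have ij : i%:R <= j%:R * (1 + eps) by apply: le_trans Jj.
have j0 : j != ord0.
  apply/eqP => ej; move: ij; rewrite ej mul0r leNgt ltr0n.
  by rewrite i0.
have moved : j \in moved_below i.
  rewrite inE ji j0 SJ /= /packed /grid /= (negbTE j0).
  apply/eqP => -[eJ]; move: iJ; rewrite eJ /= mulr1 ler_nat.
  by rewrite prednK ?lt0n // leqNgt ji.
(* Since [moved_below j] has a strict bound, j is a further moved task beyond those counted by
   induction. *)
have sub : moved_below j \subset moved_below i :\ j.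
  apply/fintype.subsetP => l; rewrite !inE => /and3P[lj -> ->].
  by rewrite (ltn_trans lj ji) !andbT; apply: contraTneq lj => ->; rewrite ltnn.
rewrite (cardsD1 j) moved add1n ltnS; apply: leq_trans (subset_leq_card sub).
apply: IH; first exact: ltnW.
exact: lt_le_trans lt ij.
Qed.

Lemma le_reallocations (t : nat) :
  c * (1 + eps) ^+ t < N.+1%:R * (1 + eps) ->
  (t <= @reallocations R packed_state S)%N.
Proof.
move=> /(moved_below_ge _ _ (leqnn _)) /leq_trans; apply.
by apply/subset_leq_card/fintype.subsetP => j; rewrite !inE => /and3P[_ -> ->].
Qed.

End Reallocation.

End Construction.

Theorem mainTheorem2 (R : realType) (eps c : R)
    (eps_gt0 : 0 < eps) (eps_lt1 : eps < 1) (hc : eps^-1 + 1 <= c) :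
  exists st : insert_state R,
    [/\ st_feasible st,
        slack eps st,
        forall i : 'I_(ntasks (st_inst st)), len (window i) = c &
        forall S' : allocation (st_inst st), solution S' ->
          Num.floor (logb (1 + eps) eps^-1) <= (reallocations S')%:Z].
Proof.
have V0 : 0 < eps^-1 by rewrite invr_gt0.
pose N := Num.truncn ((c - 1) / eps).
have /truncn_itv/andP[] : 0 <= (c - 1) / eps.
  by rewrite divr_ge0 ?(ltW eps_gt0) // subr_ge0 (le_trans _ hc) // lerDr ltW.
rewrite -/N ler_pdivlMr // => hN ltN.
exists (@packed_state R eps c N eps_gt0 hc hN); split.
- exact: packed_feasible.
- exact: packed_slack.
- exact: packed_window_len.
move=> S' solS'; rewrite leNgt; apply/negP.
(* If the number r of reallocations is below the floor, then (1+eps)^(r+1) <= 1/eps, and the chain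
   yields r+1 reallocations. *)
rewrite -lezD1 [_%:Z + 1]addrC -intS floor_ge_int -pmulrn.
set r := reallocations S'.
have eps1 : 1 < 1 + eps by rewrite ltrDl.
have eps10 : 0 < 1 + eps by apply: lt_trans eps1.
rewrite /logb ler_pdivlMr ?ln_gt0 // mulr_natl -lnXn // ler_ln ?posrE ?exprn_gt0 //.
move=> ler; suff : (r.+1 <= r)%N by rewrite ltnn.
apply: le_reallocations => //.
apply: (@le_lt_trans _ _ (c * eps^-1)).
  by rewrite ler_pM2l // (lt_le_trans _ hc) // addr_gt0.
(* By the choice of N, (c-1)/eps < N+1. The other inequality reduces to c <= (c-1)(1+eps), that is
   1+eps <= c*eps, which is [hc] times eps. *)
apply: (@le_lt_trans _ _ ((c - 1) / eps * (1 + eps))); last by rewrite ltr_pM2r.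
rewrite mulrAC ler_pM2r //.
have : (eps^-1 + 1) * eps <= c * eps by rewrite ler_pM2r.
by rewrite mulrDl mulVf ?gt_eqF //; lra.
Qed.
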